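(* Let $K$ be a field with $\mathrm{char}(K)\neq 2$ and let $\mathfrak{g}$ be a Lie algebra over $K$ that is nilpotent of class $c$. Then: (1) if $c$ is odd, $\chi(\mathfrak{g})$ is nilpotent of class at most $c+1$; (2) if $c$ is even, $\chi(\mathfrak{g})$ is nilpotent of class at most $c+2$.
   Context: For a Lie algebra $\mathfrak{g}$ over $K$, let $\mathfrak{g}^{\psi}$ be an isomorphic copy of $\mathfrak{g}$, with isomorphism written $x\mapsto x^{\psi}$. The weak commutativity construction is the Lie algebra $\chi(\mathfrak{g})=\langle \mathfrak{g},\mathfrak{g}^{\psi} \mid [x,x^{\psi}]=0 \text{ for all } x\in\mathfrak{g}\rangle$, i.e. the quotient of the free product of the Lie algebras $\mathfrak{g}$ and $\mathfrak{g}^{\psi}$ by the ideal generated by all $[x,x^{\psi}]$, $x\in\mathfrak{g}$. *)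

(* Defs.v *)
From HB Require Import structures.
From mathcomp Require Import all_boot all_order all_algebra.
From mathcomp Require Import boolp classical_sets.

Set Implicit Arguments.
Unset Strict Implicit.
Unset Printing Implicit Defensive.

Import GRing.Theory.
Local Open Scope ring_scope.
Local Open Scope quotient_scope.
Local Open Scope classical_set_scope.

HB.mixin Record Lmodule_isLieAlgebra (K : fieldType) L of GRing.Lmodule K L := {
  lie : L -> L -> L;
  lie_linearl : forall (z : L) (a : K) (x y : L),
    lie (a *: x + y) z = a *: lie x z + lie y z;
  lie_linearr : forall (z : L) (a : K) (x y : L),
    lie z (a *: x + y) = a *: lie z x + lie z y;
  liexx : forall x : L, lie x x = 0;
  lie_jacobi : forall x y z : L,
    lie x (lie y z) + lie y (lie z x) + lie z (lie x y) = 0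
}.

#[short(type="lieAlgType")]
HB.structure Definition LieAlgebra (K : fieldType) :=
  { L of GRing.Lmodule K L & Lmodule_isLieAlgebra K L }.

Notation "[lie x , y ]" := (lie x y)
  (at level 0, x, y at level 99, format "[lie  x ,  y ]") : ring_scope.

Definition lie_morphism (K : fieldType) (L M : lieAlgType K) (f : L -> M) :=
  (forall a x y, f (a *: x + y) = a *: f x + f y) /\
  (forall x y, f [lie x, y] = [lie f x, f y]).

Section Nilpotency.
Variables (K : fieldType) (L : lieAlgType K).
Implicit Types (A B : set L).

Definition is_submodule A :=
  A 0 /\ forall (a : K) x y, A x -> A y -> A (a *: x + y).

Definition lie_span A : set L := smallest is_submodule A.

Definition lie_comm A B : set L :=
  lie_span [set z | exists x y, [/\ A x, B y & z = [lie x, y]]].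

(* [lcs n] is the term usually written gamma_(n+1). *)
Fixpoint lcs (n : nat) : set L :=
  if n is m.+1 then lie_comm (lcs m) setT else setT.

Definition nilpotent_class_le (n : nat) := lcs n = [set 0].

Definition nilpotent_of_class (c : nat) :=
  nilpotent_class_le c /\ forall d, (d < c)%N -> ~ nilpotent_class_le d.

Definition is_lie_ideal A :=
  is_submodule A /\ forall x y, A x -> A [lie x, y].

Record lieIdeal := LieIdeal {
  lie_ideal_set :> L -> Prop;
  lie_idealP : is_lie_ideal lie_ideal_set }.

Lemma is_lie_ideal_smallest A : is_lie_ideal (smallest is_lie_ideal A).
Proof.
split; first split.
- by move=> B [[[]]].
- move=> a x y Ax Ay B AB; have [[[_ BD] _] _] := AB.
  by apply: BD; [apply: Ax | apply: Ay].
- by move=> x y Ax B AB; have [[_ BM] _] := AB; apply: BM; apply: Ax.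
Qed.

Definition lie_ideal_gen A : lieIdeal := LieIdeal (is_lie_ideal_smallest A).

End Nilpotency.

Section LieTheory.
Variables (K : fieldType) (L : lieAlgType K).
Implicit Types x y z : L.

Lemma lieDl x y z : [lie x + y, z] = [lie x, z] + [lie y, z].
Proof. by have := lie_linearl z 1 x y; rewrite !scale1r. Qed.

Lemma lieDr x y z : [lie z, x + y] = [lie z, x] + [lie z, y].
Proof. by have := lie_linearr z 1 x y; rewrite !scale1r. Qed.

Lemma lie0l z : [lie 0, z] = 0 :> L.
Proof. by apply: (addrI [lie 0, z]); rewrite -lieDl !addr0. Qed.

Lemma lie0r z : [lie z, 0] = 0 :> L.
Proof. by apply: (addrI [lie z, 0]); rewrite -lieDr !addr0. Qed.

Lemma lieZl a x z : [lie a *: x, z] = a *: [lie x, z].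
Proof. by have := lie_linearl z a x 0; rewrite lie0l !addr0. Qed.

Lemma lieZr a x z : [lie z, a *: x] = a *: [lie z, x].
Proof. by have := lie_linearr z a x 0; rewrite lie0r !addr0. Qed.

Lemma lieNl x z : [lie - x, z] = - [lie x, z].
Proof. by rewrite -scaleN1r lieZl scaleN1r. Qed.

Lemma lieNr x z : [lie z, - x] = - [lie z, x].
Proof. by rewrite -scaleN1r lieZr scaleN1r. Qed.

Lemma lieC x y : [lie x, y] = - [lie y, x].
Proof.
apply/eqP; rewrite -addr_eq0; apply/eqP.
by have := liexx (x + y); rewrite lieDl !lieDr !liexx add0r addr0.
Qed.

End LieTheory.

Section LieMorphismTheory.
Variables (K : fieldType) (L M : lieAlgType K) (f : L -> M).
Hypothesis fM : lie_morphism f.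

Lemma lie_morphD x y : f (x + y) = f x + f y.
Proof. by have := fM.1 1 x y; rewrite !scale1r. Qed.

Lemma lie_morph0 : f 0 = 0.
Proof. by apply: (addrI (f 0)); rewrite -lie_morphD !addr0. Qed.

Lemma lie_morphZ a x : f (a *: x) = a *: f x.
Proof. by have := fM.1 a x 0; rewrite lie_morph0 !addr0. Qed.

Lemma lie_morphN x : f (- x) = - f x.
Proof. by rewrite -scaleN1r lie_morphZ scaleN1r. Qed.

Lemma lie_morphB x y : f (x - y) = f x - f y.
Proof. by rewrite lie_morphD lie_morphN. Qed.

End LieMorphismTheory.

Section LieQuotient.
Variables (K : fieldType) (L : lieAlgType K) (I : lieIdeal L).

Lemma lideal0 : I 0. Proof. by have [[]] := lie_idealP I. Qed.

Lemma lidealD x y : I x -> I y -> I (x + y).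
Proof.
by have [[_ H] _] := lie_idealP I => Ix Iy; rewrite -[x]scale1r; apply: H.
Qed.

Lemma lidealZ a x : I x -> I (a *: x).
Proof.
have [[I0 H] _] := lie_idealP I => Ix.
by rewrite -[_ *: _]addr0; apply: H.
Qed.

Lemma lidealN x : I x -> I (- x).
Proof. by rewrite -scaleN1r; apply: lidealZ. Qed.

Lemma lideal_lier x y : I x -> I [lie x, y].
Proof. by have [_] := lie_idealP I; apply. Qed.

Lemma lideal_liel x y : I x -> I [lie y, x].
Proof. by move=> Ix; rewrite lieC; apply: lidealN; apply: lideal_lier. Qed.

Definition ideal_rel : rel L := fun x y => `[< I (x - y) >].

Lemma ideal_rel_refl : reflexive ideal_rel.
Proof. by move=> x; apply/asboolP; rewrite subrr; apply: lideal0. Qed.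

Lemma ideal_rel_sym : symmetric ideal_rel.
Proof.
by move=> x y; apply/asboolP/asboolP => /lidealN; rewrite opprB.
Qed.

Lemma ideal_rel_trans : transitive ideal_rel.
Proof.
move=> y x z /asboolP Ixy /asboolP Iyz; apply/asboolP.
by have := lidealD Ixy Iyz; rewrite addrA subrK.
Qed.

Canonical ideal_equiv :=
  EquivRel ideal_rel ideal_rel_refl ideal_rel_sym ideal_rel_trans.

Definition lieQuot : Type := {eq_quot ideal_equiv}.

HB.instance Definition _ : EqQuotient L ideal_rel lieQuot :=
  EqQuotient.on lieQuot.
HB.instance Definition _ := Choice.on lieQuot.

Definition lie_proj (x : L) : lieQuot := \pi x.

Lemma lie_proj_eqP x y : lie_proj x = lie_proj y <-> I (x - y).
Proof.
split; first by move/eqmodP => /asboolP.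
by move=> Ixy; apply/eqmodP/asboolP.
Qed.

Lemma lie_proj_surj (P : lieQuot -> Prop) :
  (forall x, P (lie_proj x)) -> forall q, P q.
Proof. by move=> H q; rewrite -[q]reprK; apply: H. Qed.

Lemma repr_proj x : I (repr (lie_proj x) - x).
Proof. by apply/lie_proj_eqP; rewrite /lie_proj reprK. Qed.

Definition qadd (p q : lieQuot) := lie_proj (repr p + repr q).
Definition qopp (p : lieQuot) := lie_proj (- repr p).
Definition qscale (a : K) (p : lieQuot) := lie_proj (a *: repr p).
Definition qlie (p q : lieQuot) := lie_proj [lie repr p, repr q].

Lemma qaddE x y : qadd (lie_proj x) (lie_proj y) = lie_proj (x + y).
Proof.
apply/lie_proj_eqP; rewrite opprD addrACA.
by apply: lidealD; apply: repr_proj.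
Qed.

Lemma qoppE x : qopp (lie_proj x) = lie_proj (- x).
Proof.
by apply/lie_proj_eqP; rewrite -opprD; apply: lidealN; apply: repr_proj.
Qed.

Lemma qscaleE a x : qscale a (lie_proj x) = lie_proj (a *: x).
Proof.
by apply/lie_proj_eqP; rewrite -scalerBr; apply: lidealZ; apply: repr_proj.
Qed.

Lemma qlieE x y : qlie (lie_proj x) (lie_proj y) = lie_proj [lie x, y].
Proof.
apply/lie_proj_eqP.
set x' := repr _; set y' := repr _.
rewrite -[X in I X](_ : [lie x' - x, y'] + [lie x, y' - y] = _).
  by apply: lidealD; [apply: lideal_lier | apply: lideal_liel]; apply: repr_proj.
by rewrite lieDl lieDr lieNl lieNr addrA subrK.
Qed.

Fact quot_addA : associative qadd.
Proof.
by elim/lie_proj_surj=> x; elim/lie_proj_surj=> y; elim/lie_proj_surj=> z;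
  rewrite !qaddE addrA.
Qed.
Fact quot_addC : commutative qadd.
Proof.
by elim/lie_proj_surj=> x; elim/lie_proj_surj=> y; rewrite !qaddE addrC.
Qed.
Fact quot_add0 : left_id (lie_proj 0) qadd.
Proof. by elim/lie_proj_surj=> x; rewrite !qaddE add0r. Qed.
Fact quot_addN : left_inverse (lie_proj 0) qopp qadd.
Proof. by elim/lie_proj_surj=> x; rewrite qoppE !qaddE addNr. Qed.

HB.instance Definition _ :=
  GRing.isZmodule.Build lieQuot quot_addA quot_addC quot_add0 quot_addN.

Lemma addqE (p q : lieQuot) : p + q = qadd p q. Proof. by []. Qed.

Fact quot_scaleA a b p : qscale a (qscale b p) = qscale (a * b) p.
Proof. by elim/lie_proj_surj: p => x; rewrite !qscaleE scalerA. Qed.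
Fact quot_scale1 : left_id 1 qscale.
Proof. by elim/lie_proj_surj=> x; rewrite !qscaleE scale1r. Qed.
Fact quot_scaleDr : right_distributive qscale +%R.
Proof.
by move=> a; elim/lie_proj_surj=> x; elim/lie_proj_surj=> y;
  rewrite !addqE !(qscaleE, qaddE) scalerDr.
Qed.
Fact quot_scaleDl p : {morph qscale^~ p : a b / a + b}.
Proof.
by elim/lie_proj_surj: p => x a b; rewrite !addqE !(qscaleE, qaddE) scalerDl.
Qed.

HB.instance Definition _ := GRing.Zmodule_isLmodule.Build K lieQuot
  quot_scaleA quot_scale1 quot_scaleDr quot_scaleDl.

Lemma scaleqE a (p : lieQuot) : a *: p = qscale a p. Proof. by []. Qed.

Fact quot_lie_linearl (r : lieQuot) (a : K) (p q : lieQuot) :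
  qlie (a *: p + q) r = a *: qlie p r + qlie q r.
Proof.
elim/lie_proj_surj: p => x; elim/lie_proj_surj: q => y.
elim/lie_proj_surj: r => z.
by rewrite !scaleqE !addqE !(qscaleE, qaddE, qlieE) lie_linearl.
Qed.
Fact quot_lie_linearr (r : lieQuot) (a : K) (p q : lieQuot) :
  qlie r (a *: p + q) = a *: qlie r p + qlie r q.
Proof.
elim/lie_proj_surj: p => x; elim/lie_proj_surj: q => y.
elim/lie_proj_surj: r => z.
by rewrite !scaleqE !addqE !(qscaleE, qaddE, qlieE) lie_linearr.
Qed.
Fact quot_liexx p : qlie p p = 0 :> lieQuot.
Proof. by elim/lie_proj_surj: p => x; rewrite qlieE liexx. Qed.
Fact quot_lie_jacobi (p q r : lieQuot) :
  qlie p (qlie q r) + qlie q (qlie r p) + qlie r (qlie p q) = 0 :> lieQuot.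
Proof.
elim/lie_proj_surj: p => x; elim/lie_proj_surj: q => y.
elim/lie_proj_surj: r => z.
by rewrite !addqE !(qlieE, qaddE) lie_jacobi.
Qed.

HB.instance Definition _ := Lmodule_isLieAlgebra.Build K lieQuot
  quot_lie_linearl quot_lie_linearr quot_liexx quot_lie_jacobi.

Lemma lie_proj_morphism : lie_morphism lie_proj.
Proof.
split=> [a x y|x y]; last exact/esym/qlieE.
by rewrite scaleqE addqE qscaleE qaddE.
Qed.

Lemma lie_proj_eq0 x : lie_proj x = 0 <-> I x.
Proof. by rewrite -(lie_morph0 lie_proj_morphism) lie_proj_eqP subr0. Qed.

Lemma lie_quot_lift (M : lieAlgType K) (f : L -> M) :
  lie_morphism f -> (forall x, I x -> f x = 0) ->
  exists2 F : lieQuot -> M, lie_morphism F & forall x, F (lie_proj x) = f x.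
Proof.
move=> fM f0; pose F (p : lieQuot) := f (repr p).
have FE x : F (lie_proj x) = f x.
  apply/eqP; rewrite -subr_eq0 -(lie_morphB fM); apply/eqP/f0.
  exact: repr_proj.
exists F => //; split.
  move=> a; elim/lie_proj_surj=> x; elim/lie_proj_surj=> y.
  by rewrite -lie_proj_morphism.1 !FE fM.1.
elim/lie_proj_surj=> x; elim/lie_proj_surj=> y.
by rewrite -lie_proj_morphism.2 !FE fM.2.
Qed.

End LieQuotient.

Arguments lie_proj {K L} I x.

(* The free product (coproduct) of two Lie algebras: formal Lie expressions in
   elements of g and h, modulo the least congruence containing the Lie algebra
   axioms and the operations of g and of h. *)
Section FreeProductTerms.
Variables (K : fieldType) (g h : lieAlgType K).

Inductive fp_term : Type :=
  | TInl of g
  | TInr of h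
  | TZero
  | TAdd of fp_term & fp_term
  | TOpp of fp_term
  | TScale of K & fp_term
  | TLie of fp_term & fp_term.

Inductive fp_eq : fp_term -> fp_term -> Prop :=
  | fp_refl t : fp_eq t t
  | fp_sym t u : fp_eq t u -> fp_eq u t
  | fp_trans t u v : fp_eq t u -> fp_eq u v -> fp_eq t v
  | fp_congD t t' u u' : fp_eq t t' -> fp_eq u u' -> fp_eq (TAdd t u) (TAdd t' u')
  | fp_congN t t' : fp_eq t t' -> fp_eq (TOpp t) (TOpp t')
  | fp_congZ a t t' : fp_eq t t' -> fp_eq (TScale a t) (TScale a t')
  | fp_congL t t' u u' : fp_eq t t' -> fp_eq u u' -> fp_eq (TLie t u) (TLie t' u')
  | fp_addA t u v : fp_eq (TAdd t (TAdd u v)) (TAdd (TAdd t u) v)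
  | fp_addC t u : fp_eq (TAdd t u) (TAdd u t)
  | fp_add0 t : fp_eq (TAdd TZero t) t
  | fp_addN t : fp_eq (TAdd (TOpp t) t) TZero
  | fp_scaleA a b t : fp_eq (TScale a (TScale b t)) (TScale (a * b) t)
  | fp_scale1 t : fp_eq (TScale 1 t) t
  | fp_scaleDr a t u :
      fp_eq (TScale a (TAdd t u)) (TAdd (TScale a t) (TScale a u))
  | fp_scaleDl a b t :
      fp_eq (TScale (a + b) t) (TAdd (TScale a t) (TScale b t))
  | fp_lie_linearl a t u v :
      fp_eq (TLie (TAdd (TScale a t) u) v) (TAdd (TScale a (TLie t v)) (TLie u v))
  | fp_lie_linearr a t u v :
      fp_eq (TLie v (TAdd (TScale a t) u)) (TAdd (TScale a (TLie v t)) (TLie v u))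
  | fp_liexx t : fp_eq (TLie t t) TZero
  | fp_jacobi t u v :
      fp_eq (TAdd (TAdd (TLie t (TLie u v)) (TLie u (TLie v t))) (TLie v (TLie t u)))
            TZero
  | fp_inl_linear a x y :
      fp_eq (TInl (a *: x + y)) (TAdd (TScale a (TInl x)) (TInl y))
  | fp_inl_lie x y : fp_eq (TInl [lie x, y]) (TLie (TInl x) (TInl y))
  | fp_inr_linear a x y :
      fp_eq (TInr (a *: x + y)) (TAdd (TScale a (TInr x)) (TInr y))
  | fp_inr_lie x y : fp_eq (TInr [lie x, y]) (TLie (TInr x) (TInr y)).

HB.instance Definition _ := gen_eqMixin fp_term.
HB.instance Definition _ := gen_choiceMixin fp_term.

Definition fp_rel : rel fp_term := fun t u => `[< fp_eq t u >].

Lemma fp_rel_refl : reflexive fp_rel.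
Proof. by move=> t; apply/asboolP; apply: fp_refl. Qed.

Lemma fp_rel_sym : symmetric fp_rel.
Proof. by move=> t u; apply/asboolP/asboolP; apply: fp_sym. Qed.

Lemma fp_rel_trans : transitive fp_rel.
Proof.
by move=> u t v /asboolP tu /asboolP uv; apply/asboolP; apply: fp_trans tu uv.
Qed.

Canonical fp_equiv := EquivRel fp_rel fp_rel_refl fp_rel_sym fp_rel_trans.

Definition freeProd : Type := {eq_quot fp_equiv}.

HB.instance Definition _ : EqQuotient fp_term fp_rel freeProd :=
  EqQuotient.on freeProd.
HB.instance Definition _ := Choice.on freeProd.

Definition fp_class (t : fp_term) : freeProd := \pi t.

Lemma fp_class_eqP t u : fp_class t = fp_class u <-> fp_eq t u.
Proof.
split; first by move/eqmodP => /asboolP.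
by move=> tu; apply/eqmodP/asboolP.
Qed.

Lemma fp_class_ind (P : freeProd -> Prop) :
  (forall t, P (fp_class t)) -> forall q, P q.
Proof. by move=> H q; rewrite -[q]reprK; apply: H. Qed.

Lemma repr_fp_class t : fp_eq (repr (fp_class t)) t.
Proof. by apply/fp_class_eqP; rewrite /fp_class reprK. Qed.

Definition fadd (p q : freeProd) := fp_class (TAdd (repr p) (repr q)).
Definition fopp (p : freeProd) := fp_class (TOpp (repr p)).
Definition fscale (a : K) (p : freeProd) := fp_class (TScale a (repr p)).
Definition flie (p q : freeProd) := fp_class (TLie (repr p) (repr q)).

Lemma faddE t u : fadd (fp_class t) (fp_class u) = fp_class (TAdd t u).
Proof. by apply/fp_class_eqP; apply: fp_congD; apply: repr_fp_class. Qed.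
Lemma foppE t : fopp (fp_class t) = fp_class (TOpp t).
Proof. by apply/fp_class_eqP; apply: fp_congN; apply: repr_fp_class. Qed.
Lemma fscaleE a t : fscale a (fp_class t) = fp_class (TScale a t).
Proof. by apply/fp_class_eqP; apply: fp_congZ; apply: repr_fp_class. Qed.
Lemma flieE t u : flie (fp_class t) (fp_class u) = fp_class (TLie t u).
Proof. by apply/fp_class_eqP; apply: fp_congL; apply: repr_fp_class. Qed.

Fact freeProd_addA : associative fadd.
Proof.
elim/fp_class_ind=> t; elim/fp_class_ind=> u; elim/fp_class_ind=> v.
rewrite !faddE.
exact/fp_class_eqP/fp_addA.
Qed.
Fact freeProd_addC : commutative fadd.
Proof.
by elim/fp_class_ind=> t; elim/fp_class_ind=> u; rewrite !faddE;
  apply/fp_class_eqP/fp_addC.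
Qed.
Fact freeProd_add0 : left_id (fp_class TZero) fadd.
Proof.
by elim/fp_class_ind=> t; rewrite !faddE; apply/fp_class_eqP/fp_add0.
Qed.
Fact freeProd_addN : left_inverse (fp_class TZero) fopp fadd.
Proof.
by elim/fp_class_ind=> t; rewrite foppE !faddE; apply/fp_class_eqP/fp_addN.
Qed.

HB.instance Definition _ := GRing.isZmodule.Build freeProd
  freeProd_addA freeProd_addC freeProd_add0 freeProd_addN.

Lemma addfE (p q : freeProd) : p + q = fadd p q. Proof. by []. Qed.

Fact freeProd_scaleA a b p : fscale a (fscale b p) = fscale (a * b) p.
Proof.
by elim/fp_class_ind: p => t; rewrite !fscaleE; apply/fp_class_eqP/fp_scaleA.
Qed.
Fact freeProd_scale1 : left_id 1 fscale.
Proof.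
by elim/fp_class_ind=> t; rewrite !fscaleE; apply/fp_class_eqP/fp_scale1.
Qed.
Fact freeProd_scaleDr : right_distributive fscale +%R.
Proof.
move=> a; elim/fp_class_ind=> t; elim/fp_class_ind=> u.
by rewrite !addfE !(fscaleE, faddE); apply/fp_class_eqP/fp_scaleDr.
Qed.
Fact freeProd_scaleDl p : {morph fscale^~ p : a b / a + b}.
Proof.
elim/fp_class_ind: p => t a b.
by rewrite !addfE !(fscaleE, faddE); apply/fp_class_eqP/fp_scaleDl.
Qed.

HB.instance Definition _ := GRing.Zmodule_isLmodule.Build K freeProd
  freeProd_scaleA freeProd_scale1 freeProd_scaleDr freeProd_scaleDl.

Lemma scalefE a (p : freeProd) : a *: p = fscale a p. Proof. by []. Qed.

Fact freeProd_lie_linearl (r : freeProd) (a : K) (p q : freeProd) :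
  flie (a *: p + q) r = a *: flie p r + flie q r.
Proof.
elim/fp_class_ind: p => t; elim/fp_class_ind: q => u; elim/fp_class_ind: r => v.
rewrite !scalefE !addfE !(fscaleE, faddE, flieE).
exact/fp_class_eqP/fp_lie_linearl.
Qed.
Fact freeProd_lie_linearr (r : freeProd) (a : K) (p q : freeProd) :
  flie r (a *: p + q) = a *: flie r p + flie r q.
Proof.
elim/fp_class_ind: p => t; elim/fp_class_ind: q => u; elim/fp_class_ind: r => v.
rewrite !scalefE !addfE !(fscaleE, faddE, flieE).
exact/fp_class_eqP/fp_lie_linearr.
Qed.
Fact freeProd_liexx p : flie p p = 0 :> freeProd.
Proof.
by elim/fp_class_ind: p => t; rewrite flieE; apply/fp_class_eqP/fp_liexx.
Qed.
Fact freeProd_lie_jacobi (p q r : freeProd) :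
  flie p (flie q r) + flie q (flie r p) + flie r (flie p q) = 0 :> freeProd.
Proof.
elim/fp_class_ind: p => t; elim/fp_class_ind: q => u; elim/fp_class_ind: r => v.
by rewrite !addfE !(flieE, faddE); apply/fp_class_eqP/fp_jacobi.
Qed.

HB.instance Definition _ := Lmodule_isLieAlgebra.Build K freeProd
  freeProd_lie_linearl freeProd_lie_linearr freeProd_liexx freeProd_lie_jacobi.

Definition fp_inl (x : g) : freeProd := fp_class (TInl x).
Definition fp_inr (y : h) : freeProd := fp_class (TInr y).

Lemma fp_inl_morphism : lie_morphism fp_inl.
Proof.
split=> [a x y|x y]; rewrite /fp_inl.
  rewrite scalefE addfE fscaleE faddE.
  exact/fp_class_eqP/fp_inl_linear.
by rewrite [RHS]flieE; apply/fp_class_eqP/fp_inl_lie.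
Qed.

Lemma fp_inr_morphism : lie_morphism fp_inr.
Proof.
split=> [a x y|x y]; rewrite /fp_inr.
  rewrite scalefE addfE fscaleE faddE.
  exact/fp_class_eqP/fp_inr_linear.
by rewrite [RHS]flieE; apply/fp_class_eqP/fp_inr_lie.
Qed.

Lemma freeProd_lift (M : lieAlgType K) (f1 : g -> M) (f2 : h -> M) :
  lie_morphism f1 -> lie_morphism f2 ->
  exists F : freeProd -> M, [/\ lie_morphism F,
    forall x, F (fp_inl x) = f1 x & forall y, F (fp_inr y) = f2 y].
Proof.
move=> f1M f2M.
pose ev := fix ev (t : fp_term) : M := match t with
  | TInl x => f1 x | TInr y => f2 y | TZero => 0
  | TAdd t u => ev t + ev u | TOpp t => - ev t
  | TScale a t => a *: ev t | TLie t u => [lie ev t, ev u] end.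
have evP t u : fp_eq t u -> ev t = ev u.
  elim=> //= {t u}.
  - by move=> t u v _ -> _ ->.
  - by move=> t t' u u' _ -> _ ->.
  - by move=> t t' _ ->.
  - by move=> a t t' _ ->.
  - by move=> t t' u u' _ -> _ ->.
  - by move=> *; rewrite addrA.
  - by move=> *; rewrite addrC.
  - by move=> *; rewrite add0r.
  - by move=> *; rewrite addNr.
  - by move=> *; rewrite scalerA.
  - by move=> *; rewrite scale1r.
  - by move=> *; rewrite scalerDr.
  - by move=> *; rewrite scalerDl.
  - by move=> *; rewrite lie_linearl.
  - by move=> *; rewrite lie_linearr.
  - by move=> *; rewrite liexx.
  - by move=> *; rewrite lie_jacobi.
  - by move=> *; rewrite f1M.1.
  - by move=> *; rewrite f1M.2.
  - by move=> *; rewrite f2M.1.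
  - by move=> *; rewrite f2M.2.
pose F (p : freeProd) := ev (repr p).
have FE t : F (fp_class t) = ev t by apply: evP; apply: repr_fp_class.
exists F; split=> [|x|y]; [|exact: (FE (TInl x))|exact: (FE (TInr y))].
split=> [a|]; elim/fp_class_ind=> t; elim/fp_class_ind=> u.
  by rewrite scalefE addfE fscaleE faddE !FE.
rewrite -[X in F X]/(flie (fp_class t) (fp_class u)).
by rewrite flieE !FE.
Qed.

Lemma freeProd_lift_uniq (M : lieAlgType K) (F G : freeProd -> M) :
  lie_morphism F -> lie_morphism G ->
  (forall x, F (fp_inl x) = G (fp_inl x)) ->
  (forall y, F (fp_inr y) = G (fp_inr y)) ->
  F =1 G.
Proof.
move=> FM GM Fl Fr; elim/fp_class_ind.
elim=> [x|y||t IHt u IHu|t IHt|a t IHt|t IHt u IHu].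
- exact: Fl.
- exact: Fr.
- by rewrite -[fp_class TZero]/(0 : freeProd) !lie_morph0.
- by rewrite -faddE -addfE !lie_morphD // IHt IHu.
- by rewrite -foppE -[fopp _]/(- fp_class t) !lie_morphN // IHt.
- by rewrite -fscaleE -scalefE !lie_morphZ // IHt.
- by rewrite -flieE -[flie _ _]/[lie fp_class t, fp_class u] FM.2 GM.2 IHt IHu.
Qed.

End FreeProductTerms.

Arguments fp_inl {K g h} x.
Arguments fp_inr {K g h} y.

Section WeakCommutativity.
Variables (K : fieldType) (g : lieAlgType K).

Definition psiCopy : Type := g.
HB.instance Definition _ := LieAlgebra.on psiCopy.

Definition psi (x : g) : psiCopy := x.

Lemma psi_morphism : lie_morphism psi. Proof. by []. Qed.
Lemma psi_bij : bijective psi. Proof. by exists id. Qed.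

Definition chi_relators : set (freeProd g psiCopy) :=
  [set [lie fp_inl x, fp_inr (psi x)] | x in [set: g]].

Definition chi : lieAlgType K := lieQuot (lie_ideal_gen chi_relators).

Lemma chi_rel (x : g) :
  [lie lie_proj (lie_ideal_gen chi_relators) (fp_inl x),
       lie_proj (lie_ideal_gen chi_relators) (fp_inr (psi x))] = 0.
Proof.
rewrite -(lie_proj_morphism _).2; apply/lie_proj_eq0.
by apply: sub_gen_smallest; exists x.
Qed.

End WeakCommutativity.

(* Main.v *)
Require Import Defs.
From mathcomp Require Import all_boot all_order all_algebra.
From mathcomp Require Import boolp classical_sets.
From mathcomp Require Import zify.

(** Inside [chi g] put [d x = x - x^psi] and [u x = x + x^psi].  Polarizing
    the relators [[x, x^psi] = 0] gives [[x, y^psi] = [x^psi, y]], which in the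
    new generators reads
      [[d x, u y] = d [x, y]]   and   [[d x, d y] + [u x, u y] = 2 u [x, y]].
    Write [q x y = [d x, d y]].  The Jacobi identity for [d x, u y, u z] then
    forces [[d x, q y z] = d [x, [y, z]]] ([lie_dq]), so [chi g] is spanned by
    the elements [d x], [u x] and [q x y]; here 2 has to be invertible in order
    to recover the generators from [d] and [u].  Give [d x] and [u x] the
    weight of [x] in the lower central series of [g], and [q x y] the sum of
    the weights of [x] and [y].  The spans [wfilt n] of the elements of high
    weight decrease at each bracket with a generator, hence contain the terms
    of the lower central series of [chi g].  In weight above [c] only the [q x y]
    survive, and it remains to decide when they vanish.

    For this, expanding [[q x y, q z w]] on either side gives the four-term
    relation [qq_relation].  If [y] and [z] have weight 1 and the total weight
    is at least [c + 2], two of the four terms involve a bracket of weight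
    above [c], and what is left is
      [q [[x, y], z] w = - q x [[z, w], y]]:
    weight can be moved from the first argument to the second, two units at a
    time ([q_eq0_step]).  When the first argument has odd weight it ends with
    weight 1, and the second with weight at least [c + 1], so that [q] is 0.
    When it has even weight it ends with weight 2, and a total weight of
    [c + 3] is needed.  If [c] is odd and the total weight is [c + 2], one of
    the two arguments has odd weight, and this is where the parity of [c]
    enters. *)

Set Implicit Arguments.
Unset Strict Implicit.
Unset Printing Implicit Defensive.

Import GRing.Theory.
Local Open Scope ring_scope.
Local Open Scope classical_set_scope.

(** * Spans and the lower central series *)

Section LowerCentralSeries.
Variables (K : fieldType) (L : lieAlgType K).
Implicit Types (A B : set L) (x y z : L).

Lemma lie_bracketr x y z :
  [lie x, [lie y, z]] = [lie [lie x, y], z] - [lie [lie x, z], y].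
Proof.
apply/eqP; rewrite -subr_eq0 -(lie_jacobi x y z); apply/eqP.
rewrite (lieC [lie x, y] z) opprB opprK -!addrA; congr (_ + _).
by rewrite (lieC [lie x, z] y) (lieC x z) lieNr opprK.
Qed.

Lemma lie_span_submodule A : is_submodule (lie_span A).
Proof.
split=> [B [[]] //|a x y Ax Ay B AB]; have [[_ BD] _] := AB.
by apply: BD; [apply: Ax | apply: Ay].
Qed.

Lemma lie_span_sub A B : is_submodule B -> A `<=` B -> lie_span A `<=` B.
Proof. by move=> Bsub AB x; apply. Qed.

Lemma mem_lie_span A x : A x -> lie_span A x.
Proof. by move=> Ax B [_]; apply. Qed.

Lemma submodD A x y : is_submodule A -> A x -> A y -> A (x + y).
Proof. by case=> _ AD Ax Ay; rewrite -[x]scale1r; apply: AD. Qed.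

Lemma submodZ A a x : is_submodule A -> A x -> A (a *: x).
Proof. by case=> A0 AD Ax; rewrite -[_ *: _]addr0; apply: AD. Qed.

Lemma submodB A x y : is_submodule A -> A x -> A y -> A (x - y).
Proof.
move=> As Ax Ay; apply: (submodD As) => //.
by rewrite -scaleN1r; apply: (submodZ _ As).
Qed.

Lemma submod0 A : is_submodule A -> A 0. Proof. by case. Qed.

Lemma preimage_submodule (M : lieAlgType K) (f : L -> M) (B : set M) :
  (forall a x y, f (a *: x + y) = a *: f x + f y) ->
  is_submodule B -> is_submodule [set x | B (f x)].
Proof.
move=> fL [B0 BD]; split=> [|a x y Bx By] /=; last by rewrite fL; apply: BD.
suff -> : f 0 = 0 by [].
by have := fL (-1) 0 0; rewrite addr0 scaler0 scaleN1r addNr.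
Qed.

Lemma zero_submodule : is_submodule [set 0 : L].
Proof. by split=> //= a x y -> ->; rewrite scaler0 addr0. Qed.

Lemma lcs_submodule n : is_submodule (lcs n : set L).
Proof. by case: n => [|n] //; apply: lie_span_submodule. Qed.

Lemma lcs_lie1 n x y : lcs n x -> lcs n.+1 [lie x, y].
Proof. by move=> nx; apply: mem_lie_span; exists x, y. Qed.

Lemma lcsS_ind n B : is_submodule B ->
  (forall x y, lcs n x -> B [lie x, y]) -> lcs n.+1 `<=` B.
Proof.
by move=> Bs H; apply: lie_span_sub => // _ [x [y [nx _ ->]]]; apply: H.
Qed.

Lemma lcsSS_ind n B : is_submodule B ->
  (forall x y z, lcs n x -> B [lie [lie x, y], z]) -> lcs n.+2 `<=` B.
Proof.
move=> Bs H; apply: lcsS_ind => // x z; move: x.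
apply: lcsS_ind => [|x y nx]; last exact: H.
apply: (preimage_submodule (f := fun x => [lie x, z])) => // *.
exact: lie_linearl.
Qed.

Lemma lcs_lie i j x y : lcs i x -> lcs j y -> lcs (i + j).+1 [lie x, y].
Proof.
elim: j i x y => [|j IH] i x y ix jy; first by rewrite addn0; apply: lcs_lie1.
move: y jy; apply: (@lcsS_ind j [set y | lcs (i + j.+1).+1 [lie x, y]]).
  apply: (preimage_submodule (f := fun y => [lie x, y])) => [*|].
    exact: lie_linearr.
  exact: lcs_submodule.
move=> y z jy; rewrite /mkset lie_bracketr addnS.
apply: (submodB (lcs_submodule _)).
  by apply: lcs_lie1; apply: IH.
by rewrite -addSn; apply: IH => //; apply: lcs_lie1.
Qed.

Lemma lcs_anti m n : (m <= n)%N -> lcs n `<=` (lcs m : set L).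
Proof.
have lcsS i : lcs i.+1 `<=` (lcs i : set L).
  elim: i => [//|i IH]; apply: lcsS_ind; first exact: lcs_submodule.
  by move=> x y /IH ix; apply: lcs_lie1.
by move=> /subnK <-; elim: (n - m)%N => [//|k IH] x /lcsS /IH.
Qed.

End LowerCentralSeries.

(** * Weakly commuting pairs of homomorphisms *)

Section WeakCommutation.
Variables (K : fieldType) (g M : lieAlgType K) (a b : g -> M).
Hypotheses (aM : lie_morphism a) (bM : lie_morphism b).
Hypothesis ab0 : forall x, [lie a x, b x] = 0.
Implicit Types x y z w : g.

Definition wdiff x := a x - b x.
Definition wsum x := a x + b x.
Notation d := wdiff.
Notation u := wsum.
Notation q x y := [lie d x, d y].

Lemma wdiff_linear k x y : d (k *: x + y) = k *: d x + d y.
Proof. by rewrite /d aM.1 bM.1 opprD scalerBr addrACA. Qed.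

Lemma wdiff0 : d 0 = 0.
Proof. by rewrite /d (lie_morph0 aM) (lie_morph0 bM) subr0. Qed.

Lemma wsum0 : u 0 = 0.
Proof. by rewrite /u (lie_morph0 aM) (lie_morph0 bM) addr0. Qed.

Lemma wdiffN x : d (- x) = - d x.
Proof. by rewrite /d (lie_morphN aM) (lie_morphN bM) opprD. Qed.

Lemma wdiffB x y : d (x - y) = d x - d y.
Proof. by rewrite addrC -scaleN1r wdiff_linear scaleN1r addrC. Qed.

(** The polarized form of the relators. *)
Lemma lie_ab_swap x y : [lie a x, b y] = [lie b x, a y].
Proof.
have := ab0 (x + y); rewrite (lie_morphD aM) (lie_morphD bM) lieDl !lieDr !ab0.
by rewrite add0r addr0 => /eqP; rewrite addr_eq0 (lieC (a y)) opprK => /eqP.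
Qed.

Lemma lie_du x y : [lie d x, u y] = d [lie x, y].
Proof.
rewrite /d /u aM.2 bM.2 lieDl !lieDr !lieNl lie_ab_swap.
by rewrite addrA addrK.
Qed.

Lemma lie_ud x y : [lie u x, d y] = d [lie x, y].
Proof.
by rewrite lieC lie_du -wdiffN -lieC.
Qed.

Lemma lie_uu x y : [lie u x, u y] = u [lie x, y] *+ 2 - q x y.
Proof.
apply/esym/eqP; rewrite subr_eq /d /u aM.2 bM.2 !lieDl !lieDr !lieNl !lieNr.
rewrite lie_ab_swap opprK; apply/eqP.
set p := [lie b x, a y]; set s := [lie a x, a y]; set t := [lie b x, b y].
have -> : s + p + (p + t) = s + t + p *+ 2.
  by rewrite [p + t]addrC addrACA mulr2n.
have -> : s - p + (- p + t) = s + t - p *+ 2.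
  by rewrite [- p + t]addrC addrACA mulr2n opprD.
by rewrite addrACA subrr addr0 mulr2n.
Qed.

(** Both [u y] and [u z] act on [d x] through brackets in [g], so
    [[u y, u z]] acts on it as [u [y, z]] does; by [lie_uu], [q y z] then acts
    in the same way. *)
Lemma lie_dq x y z : [lie d x, q y z] = d [lie x, [lie y, z]].
Proof.
have -> : q y z = u [lie y, z] *+ 2 - [lie u y, u z].
  by rewrite lie_uu opprB addrC subrK.
rewrite lieDr lieNr lie_bracketr !lie_du mulr2n lieDr lie_du.
by rewrite -wdiffB -lie_bracketr addrK.
Qed.

Lemma lie_qd x y z : [lie q x y, d z] = d [lie [lie x, y], z].
Proof.
by rewrite lieC lie_dq -wdiffN -lieC.
Qed.

Lemma lie_qu x y z : [lie q x y, u z] = q [lie x, z] y + q x [lie y, z].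
Proof.
have : [lie d x, [lie d y, u z]] = q x [lie y, z] by rewrite lie_du.
rewrite lie_bracketr lie_du => <-.
by rewrite addrC subrK.
Qed.

Lemma lie_qq x y z w : [lie q x y, q z w] =
  q [lie [lie x, y], z] w + q z [lie [lie x, y], w].
Proof. by rewrite lie_bracketr !lie_qd [in X in _ - X]lieC opprK. Qed.

(** The bracket [[q x y, q z w]] changes sign when the two factors are exchanged,
    while [lie_qq] expands it by letting its left factor act on the right one. *)
Lemma qq_relation x y z w :
  q [lie [lie x, y], z] w + q z [lie [lie x, y], w]
  + (q [lie [lie z, w], x] y + q x [lie [lie z, w], y]) = 0.
Proof. by rewrite -!lie_qq [X in X + _]lieC addNr. Qed.

(** * Vanishing of brackets of high weight *)

Section Vanishing.
Variable c : nat.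
Hypothesis gnil : nilpotent_class_le g c.

Lemma lcs_eq0 n x : (c <= n)%N -> lcs n x -> x = 0.
Proof. by move=> /lcs_anti H /H; rewrite gnil. Qed.

(** In [qq_relation] the other two terms contain [[[x, y], w]] or
    [[[z, w], x]], whose weight is above [c]. *)
Lemma q_eq0_step i j x y z w : (c <= (i + j).+2)%N -> lcs i x -> lcs j w ->
  q [lie [lie x, y], z] w = - q x [lie [lie z, w], y].
Proof.
move=> cij ix jw; have := qq_relation x y z w.
have -> : [lie [lie x, y], w] = 0.
  apply: (@lcs_eq0 (i.+1 + j).+1); first by rewrite addSn.
  by apply: lcs_lie => //; apply: lcs_lie1.
have -> : [lie [lie z, w], x] = 0.
  apply: (@lcs_eq0 (j.+1 + i).+1); first by rewrite addSn addnC.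
  by apply: lcs_lie => //; rewrite lieC -scaleN1r;
    apply: (submodZ _ (@lcs_submodule _ _ _)); apply: lcs_lie1.
by rewrite wdiff0 lie0r lie0l addr0 add0r => /eqP; rewrite addr_eq0 => /eqP.
Qed.

(** The step moves the weight of [x] to [w] in [k] rounds.  The indices of [lcs]
    are one less than weights, so that [r = 0] is the case of odd weight and
    [r = 1] that of even weight. *)
Lemma q_eq0 r k j x w : (c <= k.*2 + j)%N -> lcs (r + k.*2) x -> lcs j w ->
  q x w = 0.
Proof.
elim: k j x w => [|k IH] j x w ckj kx jw.
  by rewrite (lcs_eq0 ckj jw) wdiff0 lie0r.
move: x kx; rewrite doubleS !addnS.
apply: (@lcsSS_ind _ _ _ [set x | q x w = 0]).
  apply: (preimage_submodule (f := fun x => q x w) (B := [set 0])) => [*|].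
    by rewrite wdiff_linear lie_linearl.
  exact: zero_submodule.
move=> x y z kx /=.
rewrite (@q_eq0_step (r + k.*2) j) //; last by lia.
rewrite (IH j.+2) ?oppr0 //; first by lia.
apply: lcs_lie1; rewrite lieC -scaleN1r.
apply: (submodZ _ (@lcs_submodule _ _ _)); exact: lcs_lie1.
Qed.

Lemma q_eq0_parity i j x y : (c + ~~ odd c <= i + j)%N ->
  lcs i x -> lcs j y -> q x y = 0.
Proof.
move=> cij ix jy; have ei := odd_double_half i; have ej := odd_double_half j.
(* The test fails only if [i] is odd and [i + j = c] is odd: then [j] is even,
   and the second argument is the one of odd weight. *)
case: (boolP (c + odd i <= i + j)%N) => [ci|cN].
  by apply: (@q_eq0 (odd i) i./2 j) => //; [lia | rewrite ei].
rewrite lieC (@q_eq0 (odd j) j./2 i) ?oppr0 ?ej //.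
by lia.
Qed.

End Vanishing.

(** * The weight filtration *)

(** The index is one less than the weight, as for [lcs]: the successor in the
    last clause accounts for the two offsets of [i] and [j]. *)
Definition wfilt n : set M := lie_span [set m |
  [\/ exists2 x, lcs n x & m = d x, exists2 x, lcs n x & m = u x |
   exists i j x y, [/\ (n <= (i + j).+1)%N, lcs i x, lcs j y & m = q x y]]].

Lemma wfilt_submodule n : is_submodule (wfilt n).
Proof. exact: lie_span_submodule. Qed.

Lemma wfilt_d n x : lcs n x -> wfilt n (d x).
Proof. by move=> nx; apply: mem_lie_span; apply: Or31; exists x. Qed.

Lemma wfilt_u n x : lcs n x -> wfilt n (u x).
Proof. by move=> nx; apply: mem_lie_span; apply: Or32; exists x. Qed.

Lemma wfilt_q n i j x y : (n <= (i + j).+1)%N -> lcs i x -> lcs j y ->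
  wfilt n (q x y).
Proof. by move=> *; apply: mem_lie_span; apply: Or33; exists i, j, x, y. Qed.

Lemma wfilt_ind n (B : set M) : is_submodule B ->
  (forall x, lcs n x -> B (d x)) -> (forall x, lcs n x -> B (u x)) ->
  (forall i j x y, (n <= (i + j).+1)%N -> lcs i x -> lcs j y -> B (q x y)) ->
  wfilt n `<=` B.
Proof.
move=> Bs Bd Bu Bq; apply: lie_span_sub => // m [[x nx ->]|[x nx ->]|].
- exact: Bd.
- exact: Bu.
- by move=> [i [j [x [y [nij ix jy ->]]]]]; apply: Bq nij ix jy.
Qed.

Lemma wfilt_anti n : wfilt n.+1 `<=` wfilt n.
Proof.
apply: wfilt_ind; first exact: wfilt_submodule.
- by move=> x nx; apply: wfilt_d; apply: (lcs_anti (leqnSn n)).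
- by move=> x nx; apply: wfilt_u; apply: (lcs_anti (leqnSn n)).
- by move=> i j x y nij; apply: wfilt_q; apply: ltnW.
Qed.

(** Being a subalgebra, this set is everything as soon as it contains the
    generators. *)
Definition wfilt_lowering : set M :=
  [set m | wfilt 0 m /\ forall n f, wfilt n f -> wfilt n.+1 [lie f, m]].

Lemma wfilt_lowering_submodule : is_submodule wfilt_lowering.
Proof.
split=> [|k m1 m2 [f1 H1] [f2 H2]].
  split=> [|n f _]; first exact: (submod0 (wfilt_submodule 0)).
  by rewrite lie0r; apply: (submod0 (wfilt_submodule n.+1)).
split; first by have [_] := wfilt_submodule 0; apply.
move=> n f nf; rewrite lie_linearr; have [_] := wfilt_submodule n.+1.
by apply; [apply: H1 | apply: H2].
Qed.

Lemma wfilt_lowering_lie m1 m2 :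
  wfilt_lowering m1 -> wfilt_lowering m2 -> wfilt_lowering [lie m1, m2].
Proof.
move=> [f1 H1] [f2 H2]; split; first by apply: wfilt_anti; apply: H2.
move=> n f nf; rewrite lie_bracketr; apply: wfilt_anti.
apply: (submodB (wfilt_submodule _)).
  by apply: H2; apply: H1.
by apply: H1; apply: H2.
Qed.

Lemma wfilt_lowering_d z : wfilt_lowering (d z).
Proof.
split; first exact: wfilt_d.
move=> n; apply: (@wfilt_ind n [set f | wfilt n.+1 [lie f, d z]]).
- apply: (preimage_submodule (f := fun f => [lie f, d z])) => [*|].
    exact: lie_linearl.
  exact: wfilt_submodule.
- by move=> x nx; apply: (@wfilt_q _ n 0); rewrite ?addn0.
- by move=> x nx /=; rewrite lie_ud; apply: wfilt_d; apply: lcs_lie1.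
- move=> i j x y nij ix jy /=; rewrite lie_qd; apply: wfilt_d.
  apply: (@lcs_anti _ _ _ (i + j).+2); first by [].
  by apply: lcs_lie1; apply: lcs_lie.
Qed.

Lemma wfilt_lowering_u z : wfilt_lowering (u z).
Proof.
split; first exact: wfilt_u.
move=> n; apply: (@wfilt_ind n [set f | wfilt n.+1 [lie f, u z]]).
- apply: (preimage_submodule (f := fun f => [lie f, u z])) => [*|].
    exact: lie_linearl.
  exact: wfilt_submodule.
- by move=> x nx /=; rewrite lie_du; apply: wfilt_d; apply: lcs_lie1.
- move=> x nx /=; rewrite lie_uu.
  apply: (submodB (wfilt_submodule _)).
    by apply: (submodD (wfilt_submodule _)); apply: wfilt_u; apply: lcs_lie1.
  by apply: (@wfilt_q _ n 0); rewrite ?addn0.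
- move=> i j x y nij ix jy /=; rewrite lie_qu.
  apply: (submodD (wfilt_submodule _)).
    by apply: (@wfilt_q _ i.+1 j) => //; apply: lcs_lie1.
  by apply: (@wfilt_q _ i j.+1); rewrite ?addnS //; apply: lcs_lie1.
Qed.

Hypothesis two_neq0 : 2%:R != 0 :> K.
Hypothesis gen_ab : forall B : set M, is_submodule B ->
  (forall m1 m2, B m1 -> B m2 -> B [lie m1, m2]) ->
  (forall x, B (a x)) -> (forall x, B (b x)) -> forall m, B m.

Lemma wfilt_loweringT m : wfilt_lowering m.
Proof.
have half (v : M) : wfilt_lowering (v *+ 2) -> wfilt_lowering v.
  move=> /(submodZ 2%:R^-1 wfilt_lowering_submodule).
  by rewrite -scaler_nat scalerA mulVf // scale1r.
have lowS := wfilt_lowering_submodule.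
apply: gen_ab m => // [|x|x]; first exact: wfilt_lowering_lie.
  apply: half; have -> : a x *+ 2 = u x + d x.
    by rewrite /u /d addrACA subrr addr0 mulr2n.
  by apply: (submodD lowS); [apply: wfilt_lowering_u | apply: wfilt_lowering_d].
apply: half; have -> : b x *+ 2 = u x - d x.
  by rewrite /u /d opprB [b x - a x]addrC addrACA subrr add0r mulr2n.
by apply: (submodB lowS); [apply: wfilt_lowering_u | apply: wfilt_lowering_d].
Qed.

Lemma lcs_sub_wfilt n : lcs n `<=` wfilt n.
Proof.
elim: n => [m _|n IH]; first by have [] := wfilt_loweringT m.
apply: lcsS_ind; first exact: wfilt_submodule.
by move=> m1 m2 /IH; have [_] := wfilt_loweringT m2; apply.
Qed.

Lemma weak_commutation_nilpotent c : nilpotent_class_le g c ->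
  nilpotent_class_le M (c + ~~ odd c).+1.
Proof.
move=> gnil; have cN : (c <= (c + ~~ odd c).+1)%N by lia.
apply/seteqP; split=> [|_ ->]; last exact: (submod0 (@lcs_submodule _ M _)).
move=> m /lcs_sub_wfilt; move: m; apply: wfilt_ind; first exact: zero_submodule.
- by move=> x /(lcs_eq0 gnil cN) -> /=; rewrite wdiff0.
- by move=> x /(lcs_eq0 gnil cN) -> /=; rewrite wsum0.
- by move=> i j x y; rewrite ltnS; apply: q_eq0_parity.
Qed.

End WeakCommutation.

(** * The weak commutativity construction *)

Section Chi.
Variables (K : fieldType) (g : lieAlgType K).

Definition chi_inl (x : g) : chi g := lie_proj _ (fp_inl x).
Definition chi_inr (x : g) : chi g := lie_proj _ (fp_inr (psi x)).

Lemma chi_inl_morphism : lie_morphism chi_inl.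
Proof.
have [pL pM] := lie_proj_morphism (lie_ideal_gen (@chi_relators K g)).
have [fL fM] := @fp_inl_morphism K g (psiCopy g).
by split=> *; rewrite /chi_inl (fL, fM) (pL, pM).
Qed.

Lemma chi_inr_morphism : lie_morphism chi_inr.
Proof.
have [pL pM] := lie_proj_morphism (lie_ideal_gen (@chi_relators K g)).
have [fL fM] := @fp_inr_morphism K g (psiCopy g).
by split=> *; rewrite /chi_inr (fL, fM) (pL, pM).
Qed.

Lemma chi_generated (B : set (chi g)) : is_submodule B ->
  (forall m1 m2, B m1 -> B m2 -> B [lie m1, m2]) ->
  (forall x, B (chi_inl x)) -> (forall x, B (chi_inr x)) -> forall m, B m.
Proof.
move=> Bs Blie Bl Br; apply: lie_proj_surj; apply: fp_class_ind.
have pM := lie_proj_morphism (lie_ideal_gen (@chi_relators K g)).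
elim=> [x|y||t IHt v IHv|t IHt|k t IHt|t IHt v IHv].
- exact: Bl.
- exact: Br.
- by rewrite -[fp_class _]/(0 : freeProd _ _) (lie_morph0 pM); apply: submod0 Bs.
- by rewrite -faddE -addfE (lie_morphD pM); apply: (submodD Bs).
- rewrite -foppE -[fopp _]/(- fp_class t) (lie_morphN pM) -scaleN1r.
  exact: (submodZ _ Bs).
- by rewrite -fscaleE -scalefE (lie_morphZ pM); apply: (submodZ _ Bs).
- by rewrite -flieE -[flie _ _]/[lie fp_class t, fp_class v] pM.2; apply: Blie.
Qed.

End Chi.

Theorem theorem1p1 (K : fieldType) (charK : 2%N \notin [pchar K]%R)
    (g : lieAlgType K) (c : nat) (gnil : nilpotent_of_class g c) :
  (odd c -> nilpotent_class_le (chi g) (c + 1)) /\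
  (~~ odd c -> nilpotent_class_le (chi g) (c + 2)).
Proof.
have two_neq0 : (2%:R != 0 :> K)%R by move: charK; rewrite inE.
have := weak_commutation_nilpotent (chi_inl_morphism g) (chi_inr_morphism g)
  (@chi_rel K g) two_neq0 (@chi_generated K g) gnil.1.
by case: (odd c) => /=; rewrite ?addn0 ?addn1 ?addn2.
Qed.
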